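(* Let $(M,\omega,\Phi=(J,H))$ be a faithful semitoric system. Then its moment map image $B=\Phi(M)\subset\mathbb{R}^2$ is contractible.
   Context: Conventions. $S^1=\mathbb{R}/2\pi\mathbb{Z}$. Subsets carry the subspace topology. A map $f:X\to Y$ is proper onto its image if $f:X\to f(X)$ is proper (preimages of compact sets are compact). On a symplectic manifold $(M,\omega)$ the Hamiltonian vector field $X_F$ of $F$ is given by $\omega(X_F,\cdot)=dF$, and $\{F,G\}=\omega(X_F,X_G)$. Integrable systems. An integrable system (with two degrees of freedom) is a triple $(M,\omega,\Phi=(J,H))$ with $(M,\omega)$ a 4-dimensional symplectic manifold and $\Phi:M\to\mathbb{R}^2$ smooth with $\{J,H\}=0$ and $\Phi$ a submersion on an open dense subset of $M$. Integrable systems are assumed to have compact fibers, so $\Phi$ generates a Hamiltonian $\mathbb{R}^2$-action (the joint flow of $X_J,X_H$); ''orbit'' means orbit of this action. Almost-toric orbits. A point $p$ is singular if $\operatorname{rk}D_p\Phi<2$; the rank $k$ of an orbit is $\operatorname{rk}D_p\Phi$ at any of its points $p$. For a singular orbit $\mathcal{O}\ni p$, the linearized action of $\mathbb{R}^2$ at $p$ on the symplectic vector space $(T_p\mathcal{O})^{\omega}/T_p\mathcal{O}\cong\mathbb{R}^{2(2-k)}$ induces a Lie algebra homomorphism $\mathbb{R}^2\to\mathfrak{sp}(2(2-k);\mathbb{R})$ with image $\mathfrak{h}_{\mathcal{O}}$; $\mathcal{O}$ is non-degenerate if $\mathfrak{h}_{\mathcal{O}}$ is a Cartan subalgebra. Identify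 $\mathfrak{sp}(2m;\mathbb{R})$ with quadratic forms on $\mathbb{R}^{2m}$. A singular orbit is almost-toric if it is compact, non-degenerate and has no hyperbolic block, i.e. in suitable linear symplectic coordinates $\mathfrak{h}_{\mathcal{O}}$ is spanned by: $\frac{x_1^2+y_1^2}{2},\frac{x_2^2+y_2^2}{2}$ (rank 0, elliptic-elliptic); or $x_1y_2-x_2y_1,\ x_1y_1+x_2y_2$ (rank 0, focus-focus); or $\frac{x^2+y^2}{2}$ (rank 1, elliptic-regular). Faithful semitoric system. An integrable system $(M,\omega,\Phi=(J,H))$ on a connected 4-dimensional symplectic manifold such that: (F1) $\Phi$ is proper onto its image; (F2) all singular orbits of $\Phi$ are almost-toric; (F3) $J$ is the moment map of an effective Hamiltonian $S^1$-action; (F4) every fiber of $J$ is connected; (F5) the set of critical values of $J$ has no limit points in $J(M)$; (F6) every fiber of $J$ contains at most finitely many isolated fixed points of the $S^1$-action. *)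

(* Defs.v *)
From HB Require Import structures.
From mathcomp Require Import all_boot all_order all_algebra.
From mathcomp Require Import all_classical all_reals all_analysis.

Set Implicit Arguments.
Unset Strict Implicit.
Unset Printing Implicit Defensive.

Import Order.TTheory GRing.Theory Num.Theory.
Import numFieldNormedType.Exports.

Local Open Scope classical_set_scope.
Local Open Scope ring_scope.

(* Contractibility of A for the subspace topology. *)
Definition contractible (R : realType) (X : topologicalType) (A : set X) : Prop :=
  exists (a0 : X) (h : R * X -> X),
    [/\ A a0,
        {within `[0, 1]%classic `*` A, continuous h},
        (forall t x, `[0, 1]%classic t -> A x -> A (h (t, x))),
        (forall x, A x -> h (0, x) = x) &
        (forall x, A x -> h (1, x) = a0)].

Definition proper_onto_image (X Y : topologicalType) (f : X -> Y) : Prop :=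
  forall K : set Y, K `<=` range f -> compact K -> compact (f @^-1` K).

(* Only meaningful when U is open. *)
Fixpoint Ck (R : realType) (V W : normedModType R) (k : nat)
    (U : set V) (f : V -> W) : Prop :=
  match k with
  | 0 => forall x, U x -> {for x, continuous f}
  | k'.+1 => (forall x, U x -> differentiable f x) /\
             (forall v : V, Ck k' U (fun x => 'D_v f x))
  end.

Definition smooth_on (R : realType) (V W : normedModType R)
    (U : set V) (f : V -> W) : Prop := forall k, Ck k U f.

(* Values of [to_coord] off [dom], and of [param] off [cod], are irrelevant. *)
Record chart (R : realType) (n : nat) (M : topologicalType) := Chart {
  dom : set M;
  cod : set 'rV[R]_n;
  to_coord : M -> 'rV[R]_n;
  param : 'rV[R]_n -> M;
  dom_open : open dom;
  cod_open : open cod;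
  coord_cod : forall p, dom p -> cod (to_coord p);
  param_dom : forall x, cod x -> dom (param x);
  coordK : forall p, dom p -> param (to_coord p) = p;
  paramK : forall x, cod x -> to_coord (param x) = x;
  coord_continuous : forall p, dom p -> {for p, continuous to_coord};
  param_continuous : forall x, cod x -> {for x, continuous param}
}.

(* [chart_at p] is a preferred chart around p.  Pointwise notions below are
   computed in it; all of them are independent of that choice. *)
Record smooth_manifold (R : realType) (n : nat) (M : topologicalType) :=
  SmoothManifold {
  atlas_index : Type;
  chart_of : atlas_index -> chart R n M;
  chart_at : M -> atlas_index;
  mem_chart_at : forall p, dom (chart_of (chart_at p)) p;
  transition_smooth : forall i j : atlas_index,
    smooth_on (to_coord (chart_of i) @` (dom (chart_of i) `&` dom (chart_of j)))
              (to_coord (chart_of j) \o param (chart_of i));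
  mfd_hausdorff : hausdorff_space M;
  mfd_second_countable : @second_countable M
}.

Definition cpoint (R : realType) (n : nat) (M : topologicalType)
    (X : smooth_manifold R n M) (p : M) : 'rV[R]_n :=
  to_coord (chart_of (chart_at X p)) p.

Definition smooth_fun (R : realType) (n : nat) (M : topologicalType)
    (X : smooth_manifold R n M) (F : M -> R) : Prop :=
  forall i : atlas_index X, smooth_on (cod (chart_of i)) (F \o param (chart_of i)).

(* [sform i x] is the Gram matrix of the symplectic form in the chart i, i.e.
   omega(u, v) = u *m sform i x *m v^T.  Tangent vectors are row vectors, on
   which linear maps act on the right: 'd f x v = v *m jacobian f x. *)
Record symplectic_manifold (R : realType) (n : nat) (M : topologicalType) :=
  SymplecticManifold {
  mfd :> smooth_manifold R n M;
  sform : atlas_index mfd -> 'rV[R]_n -> 'M[R]_n;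
  form_smooth : forall i : atlas_index mfd,
    smooth_on (cod (chart_of i)) (sform i);
  form_skew : forall (i : atlas_index mfd) x, cod (chart_of i) x ->
    (sform i x)^T = - sform i x;
  form_nondegenerate : forall (i : atlas_index mfd) x, cod (chart_of i) x ->
    sform i x \in unitmx;
  form_closed : forall (i : atlas_index mfd) x, cod (chart_of i) x -> forall a b c : 'I_n,
    'D_(delta_mx 0 a) (fun y => sform i y b c) x +
    'D_(delta_mx 0 b) (fun y => sform i y c a) x +
    'D_(delta_mx 0 c) (fun y => sform i y a b) x = 0;
  form_transition : forall (i j : atlas_index mfd) p,
    dom (chart_of i) p -> dom (chart_of j) p ->
    let D := jacobian (to_coord (chart_of j) \o param (chart_of i))
                      (to_coord (chart_of i) p) in
    sform i (to_coord (chart_of i) p) =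
    D *m sform j (to_coord (chart_of j) p) *m D^T
}.

Section Hamiltonian.
Variables (R : realType) (n : nat) (M : topologicalType).
Variable S : symplectic_manifold R n M.
Implicit Types (F G : M -> R) (p : M).

Definition grad (f : 'rV[R]_n -> R) (x : 'rV[R]_n) : 'rV[R]_n :=
  \row_j 'D_(delta_mx 0 j) f x.

(* X_F in the chart i, the solution of omega(X_F, .) = dF: see [hamP]. *)
Definition ham F (i : atlas_index S) (x : 'rV[R]_n) : 'rV[R]_n :=
  grad (F \o param (chart_of i)) x *m invmx (sform i x).

Lemma hamP F (i : atlas_index S) x : smooth_fun S F -> cod (chart_of i) x -> forall v,
  (ham F i x *m sform i x *m v^T) 0 0 = 'D_v (F \o param (chart_of i)) x.
Proof.
move=> sF cx v; rewrite /ham mulmxKV ?form_nondegenerate // mxE.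
have [/(_ x cx) dF _] := sF i 1%N.
rewrite [in RHS](row_sum_delta v) deriveE // linear_sum /=.
by apply: eq_bigr => j _; rewrite !mxE deriveE // linearZ /= mulrC.
Qed.

Definition dfun F p : 'rV[R]_n :=
  grad (F \o param (chart_of (chart_at S p))) (cpoint S p).

Definition form_at p : 'M[R]_n := sform (chart_at S p) (cpoint S p).

Definition ham_at F p : 'rV[R]_n := ham F (chart_at S p) (cpoint S p).

Definition poisson F G p : R :=
  (ham_at F p *m form_at p *m (ham_at G p)^T) 0 0.

(* Linearization at p of the vector field X_F; intrinsic when X_F(p) = 0. *)
Definition lin_ham F p : 'M[R]_n := jacobian (ham F (chart_at S p)) (cpoint S p).

(* Complete integral curves of X_F. *)
Definition flow_line F (g : R -> M) : Prop :=
  continuous g /\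
  forall t (i : atlas_index S), dom (chart_of i) (g t) ->
    is_derive t (1 : R) (to_coord (chart_of i) \o g)
              (ham F i (to_coord (chart_of i) (g t))).

End Hamiltonian.

Section LinearSymplectic.
Variable R : realType.

(* Coordinates (x_1, ..., x_m, y_1, ..., y_m) on R^{2m}, with the standard
   form \sum_i dx_i /\ dy_i. *)
Definition std_form m : 'M[R]_(m + m) := block_mx 0 1%:M (- 1%:M) 0.
Definition xc m (v : 'rV[R]_(m + m)) (i : 'I_m) : R := v 0 (lshift m i).
Definition yc m (v : 'rV[R]_(m + m)) (i : 'I_m) : R := v 0 (rshift m i).

Definition sp m : set 'M[R]_(m + m) :=
  [set B | B *m std_form m + std_form m *m B^T = 0].

(* The identification of sp(2m) with quadratic forms: the quadratic form whose
   Hamiltonian vector field is the linear vector field v |-> v *m B. *)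
Definition quad_of m (B : 'M[R]_(m + m)) (v : 'rV[R]_(m + m)) : R :=
  2^-1 * (v *m B *m std_form m *m v^T) 0 0.

Definition lie k (A B : 'M[R]_k) : 'M[R]_k := A *m B - B *m A.

(* Nilpotent self-normalizing subalgebras. *)
Definition cartan_subalgebra k (g h : set 'M[R]_k) : Prop :=
  [/\ h `<=` g,
      h 0 /\ (forall c A B, h A -> h B -> h (c *: A + B)),
      (forall A B, h A -> h B -> h (lie A B)),
      (exists N : nat, forall (A : 'M[R]_k) (s : seq 'M[R]_k),
         h A -> (forall B, B \in s -> h B) -> size s = N ->
         foldl (@lie k) A s = 0) &
      (forall X, g X -> (forall B, h B -> h (lie X B)) -> h X)].

Definition spanned_by m (h : set 'M[R]_(m + m))
    (qs : seq ('rV[R]_(m + m) -> R)) : Prop :=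
  [set quad_of B | B in h] =
  [set q | exists c : nat -> R,
     q = (fun v => \sum_(i < size qs) c i * nth (fun=> 0) qs i v)].

Definition elliptic_elliptic (h : set 'M[R]_(2 + 2)) : Prop :=
  spanned_by h
    [:: (fun v => (@xc 2 v 0 ^+ 2 + @yc 2 v 0 ^+ 2) / 2);
        (fun v => (@xc 2 v 1 ^+ 2 + @yc 2 v 1 ^+ 2) / 2)].

Definition focus_focus (h : set 'M[R]_(2 + 2)) : Prop :=
  spanned_by h
    [:: (fun v => @xc 2 v 0 * @yc 2 v 1 - @xc 2 v 1 * @yc 2 v 0);
        (fun v => @xc 2 v 0 * @yc 2 v 0 + @xc 2 v 1 * @yc 2 v 1)].

Definition elliptic_regular (h : set 'M[R]_(1 + 1)) : Prop :=
  spanned_by h [:: (fun v => (@xc 1 v 0 ^+ 2 + @yc 1 v 0 ^+ 2) / 2)].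

End LinearSymplectic.

Arguments sp R m : clear implicits.

Section IntegrableSystems.
Variables (R : realType) (M : topologicalType).
Variable S : symplectic_manifold R 4 M.
Variables J H : M -> R.
Implicit Types p q : M.

Definition moment_map p : R * R := (J p, H p).

Definition dmoment p : 'M[R]_(1 + 1, 4) := col_mx (dfun S J p) (dfun S H p).

Definition rank_at p : nat := \rank (dmoment p).

Record integrable_system : Prop := IntegrableSystem {
  is_smooth : smooth_fun S J /\ smooth_fun S H;
  is_commute : forall p, poisson S J H p = 0;
  is_submersion : exists U : set M,
    [/\ open U, dense U & forall p, U p -> rank_at p = 2%N];
  is_compact_fibers : forall b, compact (moment_map @^-1` [set b])
}.

(* q = (time-t flow of X_H) ((time-s flow of X_J) p) for some s, t.  The flows
   exist for all times as the fibers of the moment map are compact. *)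
Definition joint_orbit p : set M :=
  [set q | exists (g h : R -> M) (s t : R),
     [/\ flow_line S J g, flow_line S H h, g 0 = p, h 0 = g s & h t = q]].

(* Rows spanning the tangent space at p of the orbit of p. *)
Definition orbit_tangent p : 'M[R]_(1 + 1, 4) :=
  col_mx (ham_at S J p) (ham_at S H p).

Definition singular p : Prop := (rank_at p < 2)%N.

(* The rows of E lie in (T_p O)^omega and project to a symplectic basis of
   (T_p O)^omega / T_p O, provided 2m = 4 - 2 * rank_at p. *)
Definition symplectic_coords p m (E : 'M[R]_(m + m, 4)) : Prop :=
  E *m form_at S p *m (orbit_tangent p)^T = 0 /\
  E *m form_at S p *m E^T = std_form R m.

(* h_O in the coordinates E: the endomorphisms of (T_p O)^omega / T_p O induced
   by the linearizations at p of a X_J + b X_H, where (a, b) ranges over the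
   Lie algebra of the stabilizer of p. *)
Definition linearized_action p m (E : 'M[R]_(m + m, 4)) : set 'M[R]_(m + m) :=
  [set B | exists a b : R,
     a *: ham_at S J p + b *: ham_at S H p = 0 /\
     let L := lin_ham S (fun q => a * J q + b * H q) p in
     ((E *m L - B *m E)%R <= orbit_tangent p)%MS].

Definition nondegenerate p : Prop :=
  exists E : 'M[R]_((2 - rank_at p)%N + (2 - rank_at p)%N, 4),
    symplectic_coords p E /\
    cartan_subalgebra (sp R (2 - rank_at p)%N) (linearized_action p E).

Definition no_hyperbolic_block p : Prop :=
  (rank_at p = 0%N /\
   exists E : 'M[R]_(2 + 2, 4),
     symplectic_coords p E /\
     (elliptic_elliptic (linearized_action p E) \/
      focus_focus (linearized_action p E)))
  \/
  (rank_at p = 1%N /\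
   exists E : 'M[R]_(1 + 1, 4),
     symplectic_coords p E /\ elliptic_regular (linearized_action p E)).

(* The orbit of p is almost-toric. *)
Definition almost_toric p : Prop :=
  [/\ compact (joint_orbit p), nondegenerate p & no_hyperbolic_block p].

(* A smooth action of S^1 = R / 2 pi Z, as an action of R trivial on 2 pi Z. *)
Record circle_action (a : R -> M -> M) : Prop := CircleAction {
  act0 : forall p, a 0 p = p;
  actD : forall s t p, a (s + t) p = a s (a t p);
  act_period : forall p, a (2 * pi) p = p;
  act_continuous : continuous (fun tp : R * M => a tp.1 tp.2);
  act_smooth : forall i j : atlas_index S,
    smooth_on
      [set tx : R * 'rV[R]_4 | cod (chart_of i) tx.2 /\
         dom (chart_of j) (a tx.1 (param (chart_of i) tx.2))]
      (fun tx => to_coord (chart_of j) (a tx.1 (param (chart_of i) tx.2)))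
}.

Definition effective (a : R -> M -> M) : Prop :=
  forall t, (forall p, a t p = p) -> exists k : int, t = k%:~R * (2 * pi).

(* The generator of the action a is X_F. *)
Definition moment_map_of (a : R -> M -> M) (F : M -> R) : Prop :=
  forall p, flow_line S F (a ^~ p).

Definition fixed_points (a : R -> M -> M) : set M :=
  [set p | forall t, a t p = p].

Record faithful_semitoric : Prop := FaithfulSemitoric {
  fs_connected : [set: M] !=set0 /\ connected [set: M];
  fs_integrable : integrable_system;
  fs_proper : proper_onto_image moment_map;
  fs_almost_toric : forall p, singular p -> almost_toric p;
  fs_action : exists a : R -> M -> M,
    [/\ circle_action a, effective a, moment_map_of a J &
        forall c : R,
          finite_set ((J @^-1` [set c]) `&` isolated (fixed_points a))];
  fs_fibers : forall c : R, connected (J @^-1` [set c]);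
  fs_critical : forall y : R, range J y ->
    ~ limit_point (J @` [set p | dfun S J p = 0]) y
}.

End IntegrableSystems.

(* Main.v *)
Require Import Defs.
From mathcomp Require Import all_boot all_order all_algebra.
From mathcomp Require Import all_classical all_reals all_analysis.
From mathcomp Require Import lra.
Import Order.TTheory GRing.Theory Num.Theory.
Import numFieldNormedType.Exports.

(* Slicing B by vertical lines exhibits it as {(x, y) : x in I, y in F(x)}, where
   I = J(M) and F(x) = H(J^{-1}(x)) are intervals by connectedness of M and of the
   fibres of J.  Given a continuous selection s of F, the set B contracts vertically
   onto the graph of s, and this graph, homeomorphic to I, is contractible.
   F need not be lower semicontinuous, but the hull of the values of H at the points of
   J^{-1}(x) where J is open onto I is, and it is nonempty: as J is nowhere locally
   constant, a connected set meeting both {J < c} and {J > c} contains a point of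
   {J = c} that is not a local extremum of J, for otherwise the interiors of
   {J <= c} and {J >= c} would separate it.  A continuous selection then exists
   by a direct form of Michael's theorem for interval-valued maps on a subset of the line. *)

Local Open Scope classical_set_scope.
Local Open Scope ring_scope.

(** * Limits of lattice operations and sums; weighted means in intervals *)

Lemma cvg_maxr (R : realType) (T : Type) (G : set_system T) {FG : Filter G}
    (f g : T -> R) a b :
  f @ G --> a -> g @ G --> b -> Num.max (f x) (g x) @[x --> G] --> Num.max a b.
Proof.
move=> fa gb; have c := @max_continuous _ R (a, b).
exact: (continuous2_cvg _ c fa gb).
Qed.

Lemma cvg_minr (R : realType) (T : Type) (G : set_system T) {FG : Filter G}
    (f g : T -> R) a b :
  f @ G --> a -> g @ G --> b -> Num.min (f x) (g x) @[x --> G] --> Num.min a b.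
Proof.
move=> fa gb; have c := @min_continuous _ R (a, b).
exact: (continuous2_cvg _ c fa gb).
Qed.

Lemma cvg_sumr (R : realType) (T : Type) (G : set_system T) {FG : Filter G}
    (n : nat) (f : nat -> T -> R) (a : nat -> R) :
  (forall i, f i @ G --> a i) ->
  \sum_(i < n) f i x @[x --> G] --> \sum_(i < n) a i.
Proof.
move=> fa; apply: cvg_big => [|i _]; last exact: fa.
exact: pseudometric_normed_Zmodule.add_continuous.
Qed.

(** If [d i] were negative wherever [w i] is positive, every term [w i * d i] would be nonpositive;
    as they sum to 0, all would vanish, and so would all weights. *)
Lemma weighted_sum0_ge0 (R : realType) (n : nat) (w d : nat -> R) :
  (forall i, 0 <= w i) -> 0 < \sum_(i < n) w i ->
  \sum_(i < n) w i * d i = 0 -> exists i, 0 < w i /\ 0 <= d i.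
Proof.
move=> w0 ws wd; apply: contrapT => /forallNP nex.
have dn i : 0 < w i -> d i < 0.
  by move=> wi; rewrite ltNge; apply/negP => di; apply: (nex i).
have /psumr_eq0P wd0 : forall i : 'I_n, true -> 0 <= - (w i * d i).
  move=> i _; have [wi|] := ltP 0 (w i); last first.
    by move=> wi; rewrite (_ : w i = 0) ?mul0r ?oppr0//; apply/eqP; rewrite eq_le wi w0.
  by rewrite -mulrN mulr_ge0 // oppr_ge0 ltW // dn.
suff w_0 : \sum_(i < n) w i = 0 by rewrite w_0 ltxx in ws.
apply: big1 => i _; have := wd0 _ i isT; rewrite sumrN wd oppr0 => /(_ erefl) /eqP.
rewrite oppr_eq0 mulf_eq0 => /orP[/eqP//|/eqP di].
apply/eqP; rewrite eq_le w0 andbT leNgt; apply/negP => /dn; rewrite di ltxx //.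
Qed.

(** The deviations [y i - m] from the mean have weighted sum 0, so among the indices of positive
    weight some value is at least [m] and some is at most [m]. *)
Lemma interval_weighted_mean (R : realType) (C : set R) (n : nat) (w y : nat -> R) :
  is_interval C -> (forall i, 0 <= w i) -> (forall i, 0 < w i -> C (y i)) ->
  0 < \sum_(i < n) w i ->
  C ((\sum_(i < n) w i * y i) / \sum_(i < n) w i).
Proof.
move=> IC w0 wC ws; set m := _ / _.
have wm : \sum_(i < n) w i * (y i - m) = 0.
  under eq_bigr do rewrite mulrBr.
  by rewrite sumrB -mulr_suml /m mulrC divfK ?subrr // gt_eqF.
have [i [wi yi]] := @weighted_sum0_ge0 R n w (fun i => y i - m) w0 ws wm.
have [|j [wj yj]] := @weighted_sum0_ge0 R n w (fun i => - (y i - m)) w0 ws.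
  by under eq_bigr do rewrite mulrN; rewrite sumrN wm oppr0.
apply: IC (wC _ wj) (wC _ wi) _ _; apply/andP; split; lra.
Qed.

(** * Countable partitions and selections of locally constant type *)

(** There are countably many rational intervals. Each one on which a single value [y] works for all
    points of [U] carries a tent function truncated at 0 and 1, positive exactly inside it. *)
Lemma countable_bumps (R : realType) (U : set R) (F : R -> set R) :
  (forall x, U x -> exists y, \forall x' \near x, U x' -> F x' y) ->
  exists (phi : nat -> R -> R) (y : nat -> R),
    [/\ forall n, continuous (phi n),
        forall n x, 0 <= phi n x <= 1,
        forall n x, U x -> 0 < phi n x -> F x (y n) &
        forall x, U x -> exists n, 0 < phi n x].
Proof.
move=> locF.
pose good (pq : rat * rat) (y : R) :=
  forall x, U x -> ratr pq.1 < x < ratr pq.2 -> F x y.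
pose bump (pq : rat * rat) (x : R) : R :=
  Num.min (Num.max (Num.min (x - ratr pq.1) (ratr pq.2 - x)) 0) 1.
have bumpc pq : continuous (bump pq).
  move=> x; apply: cvg_minr; last exact: cvg_cst.
  apply: cvg_maxr; last exact: cvg_cst.
  apply: cvg_minr; first by apply: cvgB; [exact: cvg_id|exact: cvg_cst].
  by apply: cvgB; [exact: cvg_cst|exact: cvg_id].
have bump01 pq x : 0 <= bump pq x <= 1.
  by rewrite /bump le_min le_max lexx orbT ler01 ge_min lexx orbT.
have bump0 pq x : (0 < bump pq x) = (ratr pq.1 < x < ratr pq.2).
  by rewrite /bump lt_min lt_max ltxx orbF ltr01 andbT lt_min !subr_gt0.
have H n : exists fy : (R -> R) * R,
    [/\ continuous fy.1, forall x, 0 <= fy.1 x <= 1,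
        forall x, U x -> 0 < fy.1 x -> F x fy.2 &
        forall pq y x, unpickle n = Some pq -> good pq y ->
          ratr pq.1 < x < ratr pq.2 -> 0 < fy.1 x].
  have [[pq [y [npq gy]]]|nex] :=
    pselect (exists pq y, unpickle n = Some pq /\ good pq y).
    exists (bump pq, y); split=> //=.
      by move=> x Ux; rewrite bump0; exact: gy.
    by move=> pq' y' x; rewrite npq => -[<-] _; rewrite bump0.
  (* An index coding no good interval gets the zero bump and an arbitrary value. *)
  exists (cst 0, 0); split=> //=.
  - by move=> x; exact: cvg_cst.
  - by move=> x; rewrite lexx ler01.
  - by move=> x _; rewrite ltxx.
  - by move=> pq y x npq gy; exfalso; apply: nex; exists pq, y.
have [fy fyP] := choice H.
exists (fun n => (fy n).1), (fun n => (fy n).2); split.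
- by move=> n; have [] := fyP n.
- by move=> n; have [] := fyP n.
- by move=> n; have [] := fyP n.
move=> x Ux; have [y /nbhs_ballP[e /= e0 eF]] := locF x Ux.
have [p px] : exists p, ratr p \in `]x - e, x[ by apply: rat_in_itvoo; lra.
have [q qx] : exists q, ratr q \in `]x, x + e[ by apply: rat_in_itvoo; lra.
move: px qx; rewrite !in_itv /= => /andP[p1 p2] /andP[q1 q2].
exists (pickle (p, q)); have [_ _ _] := fyP (pickle (p, q)).
apply; [exact: pickleK| |by rewrite /= p2 q1].
move=> x' Ux' /= /andP[px' qx']; apply: eF => //.
by rewrite /ball /= ltr_norml; apply/andP; split; lra.
Qed.

(* The weights [psi n = max 0 (phi n - n * \sum_(i < n) phi i)] vanish wherever
   some [phi k] exceeds [1 / n], [k < n], hence are locally finite. *)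
Lemma locally_finite_weights (R : realType) (U : set R) (phi : nat -> R -> R) :
  (forall n, continuous (phi n)) -> (forall n x, 0 <= phi n x <= 1) ->
  (forall x, U x -> exists n, 0 < phi n x) ->
  exists psi : nat -> R -> R,
    [/\ forall n, continuous (psi n), forall n x, 0 <= psi n x,
        forall n x, 0 < psi n x -> 0 < phi n x &
        forall x, U x -> exists N, 0 < \sum_(i < N) psi i x /\
          \forall x' \near x, forall n, (N <= n)%N -> psi n x' = 0].
Proof.
move=> phic phi01 phiU.
have phi0 n x : 0 <= phi n x by have /andP[] := phi01 n x.
have sumc N : continuous (fun x => \sum_(i < N) phi i x).
  by move=> x; apply: (@cvg_sumr _ _ _ _ _ phi (phi^~ x)) => i; exact: phic.
pose psi n x : R := Num.max (phi n x - n%:R * \sum_(i < n) phi i x) 0.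
exists psi; split.
- move=> n x; apply: cvg_maxr; last exact: cvg_cst.
  by apply: cvgB; [exact: phic|apply: cvgMl_tmp; exact: sumc].
- by move=> n x; rewrite /psi le_max lexx orbT.
- move=> n x; rewrite /psi lt_max ltxx orbF subr_gt0.
  apply: (@le_lt_trans _ _ (n%:R * \sum_(i < n) phi i x)).
  by rewrite mulr_ge0 // sumr_ge0.
move=> x /phiU [k0 k0x].
have ex : exists k, 0 < phi k x by exists k0.
(* For the least [k] with [phi k x] positive, the subtracted sum vanishes at [x], so
   [psi k x = phi k x]. *)
case: (ex_minnP ex) => k kx kmin.
have psik : psi k x = phi k x.
  rewrite /psi big1 ?mulr0 ?subr0; first by apply/max_idPl.
  move=> i _; apply/eqP; rewrite eq_le phi0 andbT leNgt; apply/negP => /kmin.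
  by rewrite leqNgt ltn_ord.
pose e := phi k x / 2; have e0 : 0 < e by rewrite /e; lra.
have [m em] : exists m : nat, e^-1 < m%:R.
  by exists (Num.bound e^-1); rewrite archi_boundP // invr_ge0 ltW.
(* Beyond [k] the subtracted sum contains [phi k], which exceeds [e] near [x]; beyond [m] its factor
   [n] exceeds [1 / e]. The product is then at least 1, an upper bound of [phi n]. *)
exists (maxn k.+1 m.+1); split.
  apply: (@lt_le_trans _ _ (psi k x)); first by rewrite psik.
  have kN : (k < maxn k.+1 m.+1)%N by rewrite leq_maxl.
  rewrite (bigD1 (Ordinal kN)) //= lerDl sumr_ge0 // => i _.
  by rewrite /psi le_max lexx orbT.
have : \forall x' \near x, e < phi k x'.
  have ek : e < phi k x by rewrite /e; lra.
  exact: (phic k x _ (lt_nbhsr ek)).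
apply: filterS => x' ex' n; rewrite geq_max => /andP[kn mn].
apply/max_idPr; rewrite subr_le0.
have /andP[_ /le_trans] := phi01 n x'; apply.
apply: (@le_trans _ _ (n%:R * e)).
  rewrite -ler_pdivrMr // div1r ltW // (lt_le_trans em) // ler_nat ltnW //.
rewrite ler_wpM2l // (le_trans (ltW ex')) //.
by rewrite (bigD1 (Ordinal kn)) //= lerDl sumr_ge0.
Qed.

(** The selection is the mean of the local values [y n] with weights [psi n]; it stays in [F x]
    because [F x] is an interval. *)
Lemma interval_selection_of_locally_constant (R : realType) (U : set R) (F : R -> set R) :
  (forall x, is_interval (F x)) ->
  (forall x, U x -> exists y, \forall x' \near x, U x' -> F x' y) ->
  exists s : R -> R, forall x, U x ->
    F x (s x) /\ s x' @[x' --> within U (nbhs x)] --> s x.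
Proof.
move=> IF /countable_bumps [phi [y [phic phi01 phiF phiU]]].
have [psi [psic psi0 psiphi psiU]] :=
  locally_finite_weights _ _ _ phic phi01 phiU.
have H x : exists N, U x -> forall n, (N <= n)%N -> psi n x = 0.
  have [/psiU[N [_ /nbhs_singleton HN]]|//] := pselect (U x); last by exists 0%N.
  by exists N.
have [N NP] := choice H.
pose r M x := (\sum_(i < M) psi i x * y i) / \sum_(i < M) psi i x.
have sumE (f : nat -> R) m n : (forall i, (m <= i)%N -> f i = 0) ->
    (forall i, (n <= i)%N -> f i = 0) -> \sum_(i < m) f i = \sum_(i < n) f i.
  wlog mn : m n / (m <= n)%N.
    move=> wl fm fn; have [mn|/ltnW nm] := leqP m n; first exact: wl.
    by apply/esym; apply: wl.
  move=> fm _; rewrite -(subnKC mn) big_split_ord /= [X in _ + X]big1 ?addr0 //.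
  by move=> i _; rewrite fm // leq_addr.
(* The cutoff [N x] comes from choice and may jump with [x]. Any cutoff past the last nonzero weight
   gives the same mean, so near a point one fixed [M] serves. *)
have rE x M : U x -> (forall n, (M <= n)%N -> psi n x = 0) -> r (N x) x = r M x.
  move=> Ux M0; rewrite /r (sumE (fun i => psi i x) (N x) M)
    ?(sumE (fun i => psi i x * y i) (N x) M) //.
  - by move=> i /(NP x Ux) ->; rewrite mul0r.
  - by move=> i /M0 ->; rewrite mul0r.
  - exact: NP.
exists (fun x => r (N x) x) => x Ux; have [M [sM0 nM]] := psiU x Ux.
have M0 := nbhs_singleton nM.
split.
  rewrite (rE x M Ux M0).
  apply: (@interval_weighted_mean R (F x) M (fun i => psi i x) y) => //.
  by move=> i /psiphi; exact: phiF.
rewrite (rE x M Ux M0).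
have rM : r M x' @[x' --> x] --> r M x.
  apply: cvgM.
    apply: (@cvg_sumr _ _ _ _ _ (fun i x => psi i x * y i) (fun i => psi i x * y i)) => i.
    by apply: cvgMr_tmp; exact: psic.
  apply: cvgV; first by rewrite gt_eqF.
  by apply: (@cvg_sumr _ _ _ _ _ psi (psi^~ x)) => i; exact: psic.
have rU := @cvg_within_filter _ _ _ (nbhs x) _ _ U rM.
move=> W /rU WM.
change (\forall z \near x, U z -> W (r M z)) in WM.
change (\forall z \near x, U z -> W (r (N z) z)).
apply: filterS2 nM WM => z zM Wz Uz; rewrite (rE z M Uz zM); exact: Wz.
Qed.

(** * Selections of lower semicontinuous interval-valued maps on the line *)

Lemma almost_minimizer (R : realType) (T : Type) (A : set T) (g : T -> R) (e : R) :
  A !=set0 -> (forall t, 0 <= g t) -> 0 < e ->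
  exists2 a, A a & forall b, A b -> g a < g b + e.
Proof.
move=> [a0 Aa0] g0 e0.
have hi : has_inf (g @` A).
  by split; [exists (g a0), a0|exists 0 => _ [t _ <-]].
have [_ [a Aa <-] ga] := inf_adherent e0 hi.
exists a => // b Ab; apply: (lt_le_trans ga); rewrite lerD2r.
by apply: (ge_inf hi.2); exists b.
Qed.

(** On [Z], where [F x] is a single point, the selection is forced to be [f]. On the relatively open
    set [U], where [F x] has several points, locally constant selections exist; [F] is shrunk there
    to [G] so that the glued selection is continuous at [Z]. *)
Lemma lsc_interval_selection (R : realType) (I : set R) (F : R -> set R) :
  (forall x, is_interval (F x)) -> (forall x, I x -> F x !=set0) ->
  (forall x y, I x -> F x y -> forall e, 0 < e ->
     \forall x' \near x, I x' -> exists2 y', F x' y' & `|y' - y| < e) ->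
  exists s : R -> R, forall x, I x ->
    F x (s x) /\ s x' @[x' --> within I (nbhs x)] --> s x.
Proof.
move=> IF F0 Flsc.
(* Nearby intervals have points close to [y1] and to [y2], hence on both sides of [y0]. *)
have Fconst x0 y1 y0 y2 : I x0 -> F x0 y1 -> F x0 y2 -> y1 < y0 < y2 ->
    \forall x' \near x0, I x' -> F x' y0.
  move=> Ix0 Fy1 Fy2 /andP[y10 y02].
  have h1 : 0 < y0 - y1 by lra.
  have h2 : 0 < y2 - y0 by lra.
  apply: filterS2 (Flsc _ _ Ix0 Fy1 _ h1) (Flsc _ _ Ix0 Fy2 _ h2).
  move=> x' H1 H2 Ix'; have [z1 Fz1 z1y] := H1 Ix'; have [z2 Fz2 z2y] := H2 Ix'.
  apply: IF Fz1 Fz2 _ _.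
  by move: z1y z2y; rewrite !ltr_norml => /andP[? ?] /andP[? ?]; apply/andP; split; lra.
have exF x : exists y, I x -> F x y.
  by have [/F0[y Fy]|] := pselect (I x); [exists y|exists 0].
have [f fP] := choice exF.
pose U := [set x | I x /\ exists y1 y2, [/\ F x y1, F x y2 & y1 < y2]].
pose Z := I `\` U.
have UI x : U x -> I x by case.
have Zf a y : Z a -> F a y -> y = f a.
  move=> [Ia nUa] Fy; have := fP a Ia => Ff.
  have [yf|fy|//] := ltgtP y (f a); exfalso; apply: nUa; split=> //.
    by exists y, (f a).
  by exists (f a), y.
have Uopen x : U x -> \forall x' \near x, I x' -> U x'.
  move=> [Ix [y1 [y2 [Fy1 Fy2 y12]]]].
  have h1 : y1 < y1 + (y2 - y1) / 3 < y2 by apply/andP; split; lra.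
  have h2 : y1 < y1 + (y2 - y1) / 2 < y2 by apply/andP; split; lra.
  apply: filterS2 (Fconst _ _ _ _ Ix Fy1 Fy2 h1) (Fconst _ _ _ _ Ix Fy1 Fy2 h2).
  move=> x' H1 H2 Ix'; split=> //.
  by exists (y1 + (y2 - y1) / 3), (y1 + (y2 - y1) / 2); split; [auto|auto|lra].
(* Local constant selections on [U] tend to [f] at [Z] once they are squeezed
   by the modulus of lower semicontinuity at every point of [Z]. *)
pose modulus a e d := forall x', I x' -> `|x' - a| < d ->
  exists2 y', F x' y' & `|y' - f a| < e.
pose G x := [set y | F x y /\ forall a e d, Z a -> 0 < e -> modulus a e d ->
  `|x - a| < d / 8 -> `|y - f a| <= 3 * e + 2 * `|x - a|].
have IG x : is_interval (G x).
  move=> y1 y2 [Fy1 G1] [Fy2 G2] y y12; split; first exact: IF Fy1 Fy2 _ y12.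
  move=> a e d Za e0 m xa; move: (G1 a e d Za e0 m xa) (G2 a e d Za e0 m xa) y12.
  by rewrite !ler_norml => /andP[? ?] /andP[? ?] /andP[? ?]; apply/andP; split; lra.
(* A small push towards an endpoint [y1] or [y2] brings [y] strictly between two values, where
   [Fconst] applies. *)
have interior x0 y (r : R) : U x0 -> F x0 y -> 0 < r ->
    exists y0, `|y0 - y| < r /\ \forall x' \near x0, I x' -> F x' y0.
  move=> [Ix0 [y1 [y2 [Fy1 Fy2 y12]]]] Fy r0.
  have [yy2|y2y] := ltP y y2.
    pose y0 := y + Num.min (r / 2) ((y2 - y) / 2).
    have m0 : 0 < Num.min (r / 2) ((y2 - y) / 2) by rewrite lt_min; apply/andP; split; lra.
    have m1 : Num.min (r / 2) ((y2 - y) / 2) <= r / 2 by rewrite ge_min lexx.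
    have m2 : Num.min (r / 2) ((y2 - y) / 2) <= (y2 - y) / 2 by rewrite ge_min lexx orbT.
    exists y0; split; first by rewrite /y0 ltr_norml; apply/andP; split; lra.
    by apply: (Fconst _ y _ y2) => //; rewrite /y0; apply/andP; split; lra.
  pose y0 := y - Num.min (r / 2) ((y - y1) / 2).
  have m0 : 0 < Num.min (r / 2) ((y - y1) / 2) by rewrite lt_min; apply/andP; split; lra.
  have m1 : Num.min (r / 2) ((y - y1) / 2) <= r / 2 by rewrite ge_min lexx.
  have m2 : Num.min (r / 2) ((y - y1) / 2) <= (y - y1) / 2 by rewrite ge_min lexx orbT.
  exists y0; split; first by rewrite /y0 ltr_norml; apply/andP; split; lra.
  by apply: (Fconst _ y1 _ y) => //; rewrite /y0; apply/andP; split; lra.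
have Gconst x0 : U x0 -> exists y, \forall x' \near x0, U x' -> G x' y.
  move=> Ux0; have [Z0|/forallNP Z0] := pselect (Z !=set0); last first.
    have [y0 [_ Fy0]] := interior x0 (f x0) 1 Ux0 (fP _ (UI _ Ux0)) ltr01.
    exists y0; apply: filterS Fy0 => x' Fx' Ux'; split; first by apply: Fx'; exact: UI.
    by move=> a e d Za; case: (Z0 a).
  have /nbhs_ballP[r1 /= r10 r1U] := Uopen x0 Ux0.
  have r1Z b : Z b -> r1 <= `|x0 - b|.
    move=> [Ib nUb]; rewrite leNgt; apply/negP => x0b.
    by apply: nUb; apply: r1U.
  have [a Za amin] : exists2 a, Z a & forall b, Z b -> `|x0 - a| < `|x0 - b| + r1 / 2.
    by apply: (@almost_minimizer _ _ Z (fun a => `|x0 - a|)) => //; lra.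
  (* As [r1] bounds distances to [Z] from below, the slack [r1 / 2] gives [|x0 - a| < 3/2 |x0 - b|],
     so [r] is less than the distance from [x0] to any [b] in [Z]. *)
  pose r := `|x0 - a| * 2 / 3.
  have r0 : 0 < r by have := r1Z a Za; rewrite /r; lra.
  have rZ b : Z b -> r < `|x0 - b|.
    by move=> Zb; have := r1Z b Zb; have := amin b Zb; rewrite /r; lra.
  have r20 : 0 < r / 2 by lra.
  have [y1 Fy1 y1min] : exists2 y, F x0 y &
      forall y', F x0 y' -> `|y - f a| < `|y' - f a| + r / 2.
    by apply: (@almost_minimizer _ _ (F x0) (fun y => `|y - f a|)) => //; apply: F0; exact: UI.
  have [y0 [y01 Fy0]] := interior x0 y1 (r / 2) Ux0 Fy1 r20.
  have y0min y' : F x0 y' -> `|y0 - f a| < `|y' - f a| + r.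
    by move=> /y1min; have := ler_distD y1 y0 (f a); lra.
  have r4 : \forall x' \near x0, `|x0 - x'| < r / 4.
    by apply/nbhs_ballP; exists (r / 4) => //=; lra.
  exists y0; apply: filterS2 r4 Fy0 => x x0x Fx Ux; split; first by apply: Fx; exact: UI.
  (* From [r < |x0 - a'|] and [|x0 - x| < r / 4] follow [r < 2 |x - a'|] and, by the factor 8, that
     [a] and [x0] lie within [d] of [a']. The modulus puts [f a] and some [y'] in [F x0] within [e]
     of [f a']; near-minimality of [y0] then gives [|y0 - f a'| < 3 e + r]. *)
  move=> a' e d Za' e0 m xa'.
  have t1 := ler_distD x x0 a'.
  have t2 := ler_distD x0 a a'.
  have rZa' := rZ a' Za'.
  have ra : `|a - x0| = r * 3 / 2 by rewrite distrC /r; lra.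
  have [||y Fay ya'] := m a; [by case: Za|lra|].
  rewrite (Zf a y Za Fay) in ya'.
  have [||y' Fx0y' y'a'] := m x0; [exact: UI|lra|].
  have t3 := y0min y' Fx0y'.
  have t4 := ler_distD (f a) y0 (f a').
  have t5 := ler_distD (f a') y' (f a).
  have t6 := distrC (f a) (f a').
  lra.
have [g gP] := @interval_selection_of_locally_constant R U G IG Gconst.
exists (fun x => if `[<U x>] then g x else f x) => x Ix.
have [Ux|nUx] := asboolP (U x).
  have [[Fg _] gc] := gP x Ux; split=> // W /gc gW.
  change (\forall z \near x, U z -> W (g z)) in gW.
  change (\forall z \near x, I z -> W (if `[<U z>] then g z else f z)).
  apply: filterS2 gW (Uopen x Ux) => z gz Uz Iz.
  by rewrite asboolT; [apply: gz|]; exact: Uz.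
split; first exact: fP.
have Zx : Z x by [].
apply/cvgrPdist_lt => e e0.
(* With [|x - z| < e / 6], the bound defining [G] is below [3 e / 6 + 2 e / 6 < e]. *)
have e6 : 0 < e / 6 by lra.
have /nbhs_ballP[d /= d0 dP] := Flsc x (f x) Ix (fP x Ix) _ e6.
have m : modulus x (e / 6) d.
  by move=> x' Ix' xx'; apply: dP => //; rewrite /ball/= distrC.
have n1 : \forall z \near x, `|x - z| < d / 8.
  by apply/nbhs_ballP; exists (d / 8) => //=; lra.
have n2 : \forall z \near x, `|x - z| < e / 6.
  by apply/nbhs_ballP; exists (e / 6).
change (\forall z \near x, I z -> `|f x - (if `[<U z>] then g z else f z)| < e).
apply: filterS2 n1 n2 => z; rewrite !(distrC x) => z1 z2 Iz; rewrite distrC.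
have [Uz|nUz] := asboolP (U z).
  have [[_ Gz] _] := gP z Uz.
  by have := Gz x (e / 6) d Zx e6 m z1; lra.
have [|y Fy yx] := m z Iz; first lra.
by rewrite (Zf z y _ Fy) in yx => //; lra.
Qed.

(** * Points where a function is open onto its range *)

Definition nowhere_locally_constant {R : realType} {T : topologicalType} (f : T -> R) :=
  forall (p : T) (c : R), ~ (\forall q \near p, f q = c).

(* [f] takes values on both sides of [f p] arbitrarily close to [p], as far as
   the global range of [f] allows. *)
Definition open_at {R : realType} {T : topologicalType} (f : T -> R) (p : T) :=
  ((\forall q \near p, f q <= f p) -> forall q, f q <= f p) /\
  ((\forall q \near p, f p <= f q) -> forall q, f p <= f q).

(** A point at level [c] outside both [lo] and [up] is no local extremum, so it is open. Without
    such points in [V], the disjoint open sets [lo] and [up] would cover [V] and separate [p] from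
    [q]. *)
Lemma connected_open_at (R : realType) (T : topologicalType) (f : T -> R)
    (V : set T) (p q : T) (c : R) :
  continuous f -> nowhere_locally_constant f -> connected V ->
  V p -> V q -> f p < c -> c < f q ->
  exists2 r, V r & f r = c /\ open_at f r.
Proof.
move=> cf nf cV Vp Vq pc cq; apply: contrapT => nex.
pose lo := interior [set r | f r <= c]; pose up := interior [set r | c <= f r].
have lo_lt r : f r < c -> lo r.
  by move=> rc; apply: filterS (cvgr_lt _ (cf r) c rc) => s /ltW.
have up_gt r : c < f r -> up r.
  by move=> rc; apply: filterS (cvgr_gt _ (cf r) c rc) => s /ltW.
have disj r : lo r -> up r -> False.
  move=> lr ur; apply: (nf r c); apply: filterS2 lr ur => s /= sc cs.
  by apply/eqP; rewrite eq_le sc cs.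
have VE : V `&` lo = V `&` ~` up.
  apply/seteqP; split=> [r [Vr lr]|r [Vr ur]]; split=> //; first exact: disj.
  have [/lo_lt//|/up_gt//|rc] := ltgtP (f r) c.
  apply: contrapT => nlr; apply: nex; exists r => //; split=> //.
  by split; rewrite rc => h; exfalso; [exact: nlr|exact: ur].
have VloV : V `&` lo = V.
  apply: cV.
  - by exists p; split=> //; exact: lo_lt.
  - by exists lo => //; exact: open_interior.
  - by exists (~` up) => //; apply: open_closedC; exact: open_interior.
have [_ /(disj q)] : (V `&` lo) q by rewrite VloV.
by apply; exact: up_gt.
Qed.

(** A global extremum is itself open, since being also a local extremum of the other kind would make
    [f] locally constant. Any other level is strictly between two values. *)
Lemma open_at_exists (R : realType) (T : topologicalType) (f : T -> R) (p : T) :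
  continuous f -> nowhere_locally_constant f -> connected [set: T] ->
  exists2 r, f r = f p & open_at f r.
Proof.
move=> cf nf cT.
have [/existsNP[a /negP pa]|pmin] := pselect (~ forall q, f p <= f q); last first.
  exists p => //; split=> [|_]; last exact: contrapT.
  move/contrapT: pmin => pmin pmax; exfalso; apply: (nf p (f p)).
  by apply: filterS pmax => s sp; apply/eqP; rewrite eq_le sp pmin.
have [/existsNP[b /negP pb]|pmax] := pselect (~ forall q, f q <= f p); last first.
  exists p => //; split=> [_|]; first exact: contrapT.
  move/contrapT: pmax => pmax pmin; exfalso; apply: (nf p (f p)).
  by apply: filterS pmin => s sp; apply/eqP; rewrite eq_le sp pmax.
rewrite -ltNge in pa; rewrite -ltNge in pb.
have [r _ [rp r_open]] := connected_open_at R T f _ a b (f p) cf nf cT I I pa pb.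
by exists r.
Qed.

Definition locally_connected_space (T : topologicalType) :=
  forall (p : T) (W : set T), nbhs p W ->
    exists V, [/\ nbhs p V, V `<=` W & connected V].

(** In a connected neighbourhood [V] of [p], either [f] takes a value below [f p], and all levels in
    between have open points in [V], or [p] is a local, hence global, minimum and no lower level is
    in the range. The same holds above. *)
Lemma open_at_lsc (R : realType) (T : topologicalType) (f : T -> R) (p : T) (W : set T) :
  continuous f -> nowhere_locally_constant f -> locally_connected_space T ->
  open_at f p -> nbhs p W ->
  \forall c \near f p, range f c -> exists2 q, W q & f q = c /\ open_at f q.
Proof.
move=> cf nf lc [pmax pmin] /lc[V [Vp VW cV]].
have pV : V p by exact: nbhs_singleton.
have lo : \forall c \near f p, range f c -> c < f p ->
    exists2 q, W q & f q = c /\ open_at f q.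
  have [[a Va ap]|na] := pselect (exists2 a, V a & f a < f p).
    apply: filterS (lt_nbhsr ap) => c ac _ cp.
    have [q Vq qP] := connected_open_at _ _ f V a p c cf nf cV Va pV ac cp.
    by exists q => //; exact: VW.
  have gmin : forall q, f p <= f q.
    apply: pmin; apply: filterS Vp => s Vs; rewrite leNgt; apply/negP => sp.
    by apply: na; exists s.
  by apply: (@filterE _ (nbhs (f p))) => c [q _ <-]; rewrite ltNge gmin.
have up : \forall c \near f p, range f c -> f p < c ->
    exists2 q, W q & f q = c /\ open_at f q.
  have [[a Va ap]|na] := pselect (exists2 a, V a & f p < f a).
    apply: filterS (lt_nbhsl ap) => c ac _ cp.
    have [q Vq qP] := connected_open_at _ _ f V p a c cf nf cV pV Va cp ac.
    by exists q => //; exact: VW.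
  have gmax : forall q, f q <= f p.
    apply: pmax; apply: filterS Vp => s Vs; rewrite leNgt; apply/negP => sp.
    by apply: na; exists s.
  by apply: (@filterE _ (nbhs (f p))) => c [q _ <-]; rewrite ltNge gmax.
apply: filterS2 lo up => c loc upc rc.
have [/(loc rc)//|/(upc rc)//|cp] := ltgtP c (f p).
by exists p; [exact: VW|rewrite cp].
Qed.

(** * Continuous selection from the images of the fibres *)

Lemma fibre_selection (R : realType) (T : topologicalType) (J H : T -> R) :
  continuous J -> continuous H -> nowhere_locally_constant J ->
  locally_connected_space T -> connected [set: T] ->
  (forall c, is_interval (H @` (J @^-1` [set c]))) ->
  exists s : R -> R, forall c, range J c ->
    (H @` (J @^-1` [set c])) (s c) /\
    s c' @[c' --> within (range J) (nbhs c)] --> s c.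
Proof.
move=> cJ cH nJ lc cT IF.
pose F c := [set y | exists p q, [/\ J p = c, J q = c,
  open_at J p, open_at J q & H p <= y <= H q]].
have [|||s sP] := @lsc_interval_selection R (range J) F.
- move=> c y1 y2 [p1 [_ [p1c _ op1 _ /andP[py1 _]]]].
  move=> [_ [q2 [_ q2c _ oq2 /andP[_ yq2]]]] y /andP[y1y yy2].
  by exists p1, q2; split=> //; rewrite (le_trans py1 y1y) (le_trans yy2 yq2).
- move=> _ [p _ <-]; have [r rp ro] := open_at_exists _ _ J p cJ nJ cT.
  by exists (H r), r, r; rewrite lexx.
- move=> c y _ [p [q [pc qc op oq /andP[py yq]]]] e e0.
  have near_H r : J r = c -> open_at J r -> \forall c' \near c, range J c' ->
      exists2 r', `|H r' - H r| < e & J r' = c' /\ open_at J r'.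
    move=> <- ro; apply: (open_at_lsc _ _ J r [set r' | `|H r' - H r| < e]) => //.
    have /cvgrPdist_lt/(_ e e0) := cH r.
    by apply: filterS => r'; rewrite distrC.
  apply: filterS2 (near_H p pc op) (near_H q qc oq) => c' P' Q' rc'.
  have [p' p'p [p'c' op']] := P' rc'; have [q' q'q [q'c' oq']] := Q' rc'.
  move: p'p q'q; rewrite !ltr_norml => /andP[? ?] /andP[? ?].
  (* The nearby value is [y] clamped between [H p'] and [H q'], whose order may differ from that of
     [H p] and [H q]. *)
  have [p'q'|q'p'] := leP (H p') (H q').
    have [yp'|p'y] := leP y (H p').
      exists (H p'); last by rewrite ltr_norml; apply/andP; split; lra.
      by exists p', q'; rewrite lexx.
    have [yq'|q'y] := leP y (H q').
      exists y; last by rewrite subrr normr0.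
      by exists p', q'; rewrite (ltW p'y).
    exists (H q'); last by rewrite ltr_norml; apply/andP; split; lra.
    by exists p', q'; rewrite lexx andbT.
  have [yq'|q'y] := leP y (H q').
    exists (H q'); last by rewrite ltr_norml; apply/andP; split; lra.
    by exists q', p'; rewrite lexx ltW.
  have [yp'|p'y] := leP y (H p').
    exists y; last by rewrite subrr normr0.
    by exists q', p'; rewrite (ltW q'y).
  exists (H p'); last by rewrite ltr_norml; apply/andP; split; lra.
  by exists q', p'; rewrite lexx (ltW q'p').
exists s => c rc; have [[p [q [pc qc _ _ yH]]] sc] := sP c rc; split=> //.
by apply: (IF c (H p) (H q)) yH; [exists p|exists q].
Qed.

(** * Contraction of a region fibred in intervals over an interval *)

Lemma contractible_of_selection (R : realType) (I : set R) (F : R -> set R) (s : R -> R) :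
  I !=set0 -> is_interval I -> (forall x, is_interval (F x)) ->
  (forall x, I x -> F x (s x) /\ s x' @[x' --> within I (nbhs x)] --> s x) ->
  contractible R [set p : R * R | I p.1 /\ F p.1 p.2].
Proof.
move=> [x0 Ix0] II IF sP; set A := [set p : R * R | _].
have Fs x : I x -> F x (s x) by move=> /sP[].
(* [a] runs from 0 to 1 on the first half of the time interval, [b] on the second. *)
pose a (t : R) : R := Num.min (2 * t) 1.
pose b (t : R) : R := Num.max (2 * t - 1) 0.
pose xb (z : R * (R * R)) : R := (1 - b z.1) * z.2.1 + b z.1 * x0.
(* First slide vertically to the graph of [s], then along the graph; the
   difference [s (xb z) - s z.2.1] vanishes during the first stage. *)
pose h (z : R * (R * R)) : R * R :=
  (xb z, (1 - a z.1) * z.2.2 + a z.1 * s z.2.1 + (s (xb z) - s z.2.1)).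
have b01 t : 0 <= t <= 1 -> 0 <= b t <= 1.
  by move=> /andP[t0 t1]; rewrite /b le_max lexx orbT ge_max ler01 andbT; lra.
have Ixb z : 0 <= z.1 <= 1 -> I z.2.1 -> I (xb z).
  move=> /b01 /andP[b0 b1] Ix; have [xx0|x0x] := leP z.2.1 x0.
    by apply: (II z.2.1 x0) => //; rewrite /xb; apply/andP; split; nra.
  by apply: (II x0 z.2.1) => //; rewrite /xb; apply/andP; split; nra.
exists (x0, s x0), h; split.
- by split => //=; exact: Fs.
- apply/subspace_continuousP => -[t [x y]] [/= t01 [/= Ix Fxy]].
  set D := `[0, 1]%classic `*` A; set G := within D (nbhs (t, (x, y))).
  have G1 : z.1 @[z --> G] --> t by apply: cvg_within_filter; exact: cvg_fst.
  have G2 : z.2 @[z --> G] --> (x, y) by apply: cvg_within_filter; exact: cvg_snd.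
  have Gx : z.2.1 @[z --> G] --> x by apply: (cvg_comp _ _ G2); exact: cvg_fst.
  have Gy : z.2.2 @[z --> G] --> y by apply: (cvg_comp _ _ G2); exact: cvg_snd.
  (* [s] is continuous only along [I], so a composite needs its inner map to send [D] into [I]. *)
  have Gs (g : R * (R * R) -> R) (l : R) : I l -> g @ G --> l ->
      (forall z, D z -> I (g z)) -> s (g z) @[z --> G] --> s l.
    move=> Il gl gI W /(proj2 (sP l Il)) sW.
    have gW : G [set z | I (g z) -> W (s (g z))] := gl _ sW.
    change (\forall z \near (t, (x, y)), D z -> W (s (g z))).
    change (\forall z \near (t, (x, y)), D z -> I (g z) -> W (s (g z))) in gW.
    by apply: filterS gW => z zW Dz; apply: zW => //; exact: gI.
  have D01 z : D z -> 0 <= z.1 <= 1.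
    by move=> [/=]; rewrite in_itv.
  have Gb : b z.1 @[z --> G] --> b t.
    apply: cvg_maxr; last exact: cvg_cst.
    by apply: cvgB; [apply: cvgMl_tmp|exact: cvg_cst].
  have Ga : a z.1 @[z --> G] --> a t.
    by apply: cvg_minr; [apply: cvgMl_tmp|exact: cvg_cst].
  have Gxb : xb z @[z --> G] --> xb (t, (x, y)).
    apply: cvgD; last exact: cvgMr_tmp.
    by apply: cvgM => //; apply: cvgB => //; exact: cvg_cst.
  have Gsx : s z.2.1 @[z --> G] --> s x by apply: Gs => // z [_ []].
  have Gsxb : s (xb z) @[z --> G] --> s (xb (t, (x, y))).
    apply: Gs => //; first by apply: Ixb => //=; move: t01; rewrite in_itv.
    by move=> z Dz; apply: Ixb; [exact: D01|case: Dz => _ []].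
  have Gh2 : (h z).2 @[z --> G] --> (h (t, (x, y))).2.
    apply: cvgD; last exact: cvgB.
    apply: cvgD; last exact: cvgM.
    by apply: cvgM => //; apply: cvgB => //; exact: cvg_cst.
  exact: (cvg_pair Gxb Gh2).
- move=> t [x y] /=; rewrite in_itv /= => t01 [/= Ix Fxy]; split => /=.
    exact: Ixb.
  have [t2|t2] := leP t (1 / 2).
    have bE : b t = 0 by apply/max_idPr; lra.
    have aE : a t = 2 * t by apply/min_idPl; lra.
    have xbE : xb (t, (x, y)) = x by rewrite /xb /= bE; lra.
    rewrite xbE subrr addr0 aE; move/andP: t01 => [t0 t1].
    have [yx|xy] := leP y (s x).
      by apply: (IF x y (s x)) => //; [exact: Fs|apply/andP; split; nra].
    by apply: (IF x (s x) y) => //; [exact: Fs|apply/andP; split; nra].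
  have aE : a t = 1 by apply/min_idPr; lra.
  rewrite aE subrr mul0r add0r mul1r addrC subrK.
  by apply: Fs; exact: Ixb.
- move=> [x y] _; have bE : b 0 = 0 by apply/max_idPr; lra.
  have aE : a 0 = 0 by rewrite /a mulr0; apply/min_idPl.
  have xbE : xb (0, (x, y)) = x by rewrite /xb /= bE; lra.
  by rewrite /h xbE /= aE; congr pair; lra.
- move=> [x y] _; have bE : b 1 = 1 by rewrite /b max_l; lra.
  have aE : a 1 = 1 by apply/min_idPr; lra.
  have xbE : xb (1, (x, y)) = x0 by rewrite /xb /= bE; lra.
  by rewrite /h xbE /= aE; congr pair; lra.
Qed.

(** * Topology of manifolds and of integrable systems *)

(** A ball is the union of the segments from its centre. *)
Lemma connected_ball (R : realType) (V : normedModType R) (c : V) (e : R) :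
  connected (ball c e).
Proof.
pose seg (v : V) := (fun t : R => c + t *: (v - c)) @` `[0, 1]%classic.
have -> : ball c e = \bigcup_(v in ball c e) seg v.
  apply/seteqP; split=> [v cv|w [v cv [t /= t01 <-]]].
    by exists v => //; exists 1; rewrite /= ?in_itv /= ?ler01 ?lexx // scale1r addrC subrK.
  move: cv t01; rewrite -ball_normE /= in_itv /= => cv /andP[t0 t1].
  rewrite opprD addrA subrr add0r normrN normrZ ger0_norm // distrC.
  by rewrite (le_lt_trans _ cv) // ler_piMl.
apply: bigcup_connected.
  by exists c => v cv; exists 0; rewrite /= ?in_itv /= ?lexx ?ler01 // scale0r addr0.
move=> v cv; apply: connected_continuous_connected; first exact: segment_connected.
apply: continuous_subspaceT => t; apply: cvgD; first exact: cvg_cst.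
by apply: cvgZr_tmp; exact: cvg_id.
Qed.

Lemma manifold_locally_connected (R : realType) (n : nat) (M : topologicalType)
    (X : smooth_manifold R n M) : locally_connected_space M.
Proof.
move=> p W Wp; set C := chart_of (chart_at X p); set c := to_coord C p.
have Cp : dom C p := mem_chart_at X p.
have cc : cod C c by exact: coord_cod.
have paramc : param C c = p by exact: coordK.
have pW : \forall x \near c, W (param C x).
  by apply: (param_continuous cc); rewrite paramc.
have pC : \forall x \near c, cod C x by apply: open_nbhs_nbhs; split=> //; exact: cod_open.
have [e /= e0 eP] := (nbhs_ballP _ _).1 (filterI pW pC).
exists (param C @` ball c e); split.
- have d1 : \forall q \near p, dom C q by apply: open_nbhs_nbhs; split=> //; exact: dom_open.
  have d2 : \forall q \near p, ball c e (to_coord C q).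
    exact: (Defs.coord_continuous Cp (nbhsx_ballx c e e0)).
  by apply: filterS2 d1 d2 => q Cq cq; exists (to_coord C q) => //; exact: coordK.
- by move=> _ [x /eP[Wx _] <-].
- apply: connected_continuous_connected; first exact: connected_ball.
  apply/subspace_continuousP => x /eP[_ Cx].
  by apply: cvg_within_filter; exact: param_continuous.
Qed.

Lemma smooth_fun_continuous (R : realType) (n : nat) (M : topologicalType)
    (X : smooth_manifold R n M) (F : M -> R) : smooth_fun X F -> continuous F.
Proof.
move=> sF p; set C := chart_of (chart_at X p).
have Cp : dom C p := mem_chart_at X p.
have Fc : {for to_coord C p, continuous (F \o param C)}.
  by apply: (sF (chart_at X p) 0%N); exact: coord_cod.
have FK q : dom C q -> F (param C (to_coord C q)) = F q by move=> Cq; rewrite coordK.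
have d1 : \forall q \near p, dom C q by apply: open_nbhs_nbhs; split=> //; exact: dom_open.
move=> W WFp; have FW : \forall x \near to_coord C p, W (F (param C x)).
  by apply: Fc; rewrite /= FK.
have d2 : \forall q \near p, W (F (param C (to_coord C q))).
  exact: (Defs.coord_continuous Cp FW).
by apply: filterS2 d1 d2 => q /= Cq; rewrite FK.
Qed.

(** An open set on which [J] is constant would meet the dense set of rank 2 points; there [dJ = 0]
    leaves rank at most 1. *)
Lemma integrable_nowhere_locally_constant (R : realType) (M : topologicalType)
    (S : symplectic_manifold R 4 M) (J H : M -> R) :
  integrable_system S J H -> nowhere_locally_constant J.
Proof.
move=> [_ _ [U [_ dU rkU]] _] p c /nbhs_interior Jc.
have [||q [Jq Uq]] := dU (interior [set q | J q = c]); last first.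
- have := rkU q Uq; rewrite /rank_at /dmoment.
  suff -> : dfun S J q = 0.
    rewrite rank_col_0mx => rk2; have := rank_leq_row (dfun S H q).
    by rewrite rk2.
  apply/rowP => j; rewrite !mxE.
  have Cq := mem_chart_at S q.
  rewrite (@near_eq_derive _ _ _ _ (cst c)) ?derive_cst //.
  have Jq' : \forall r \near param (chart_of (chart_at S q)) (Defs.cpoint S q), J r = c.
    by rewrite /Defs.cpoint coordK.
  exact: (param_continuous (coord_cod Cq) Jq').
- exact: open_interior.
- by exists p; exact: nbhs_singleton.
Qed.

(** * Contractibility of the moment map image *)

Theorem corollary4p5 (R : realType) (M : topologicalType)
    (S : symplectic_manifold R 4 M) (J H : M -> R) :
  faithful_semitoric S J H -> contractible R (range (moment_map J H)).
Proof.
move=> [[[p0 _] cM] /[dup] iS [[sJ sH] _ _ _] _ _ _ cfib _].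
have cJ := smooth_fun_continuous _ _ _ _ _ sJ.
have cH := smooth_fun_continuous _ _ _ _ _ sH.
have nJ := integrable_nowhere_locally_constant _ _ _ _ _ iS.
have lc := manifold_locally_connected _ _ _ S.
have IF c : is_interval (H @` (J @^-1` [set c])).
  apply/connected_intervalP/connected_continuous_connected; first exact: cfib.
  exact: continuous_subspaceT.
have [s sP] := fibre_selection _ _ J H cJ cH nJ lc cM IF.
have -> : range (moment_map J H) =
    [set p | range J p.1 /\ (H @` (J @^-1` [set p.1])) p.2].
  apply/seteqP; split=> [_ [p _ <-]|[x y] [/= _ [p Jp Hp]]].
    by split; exists p.
  by exists p => //; rewrite /moment_map Jp Hp.
apply: (@contractible_of_selection R _ (fun x => H @` (J @^-1` [set x])) s).
- by exists (J p0), p0.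
- apply/connected_intervalP/connected_continuous_connected => //.
  exact: continuous_subspaceT.
- exact: IF.
- exact: sP.
Qed.
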